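(* (Löwenheim–Skolem theorem for graph models) For every graph model ${\cal G}$ there exists a sub graph model ${\cal P}$ of ${\cal G}$ with a countable carrier set such that ${\rm Ord}({\cal P})={\rm Ord}({\cal G})$, and hence ${\rm Eq}({\cal P})={\rm Eq}({\cal G})$.
   Context: A graph model is ${\cal G}=(G,c_{\cal G})$ with $G$ an infinite set and $c_{\cal G}:G^*\times G\to G$ injective and total ($G^*$ = finite subsets of $G$). Interpretation of $\lambda$-terms in ${\cal P}(G)$ for $\rho:Var\to{\cal P}(G)$: $x_\rho=\rho(x)$; $(MN)_\rho=\{\alpha:\exists a\subseteq N_\rho\text{ finite}, c_{\cal G}(a,\alpha)\in M_\rho\}$; $(\lambda x.M)_\rho=\{c_{\cal G}(a,\alpha):a\in G^*,\alpha\in M_{\rho[x:=a]}\}$. ${\rm Ord}({\cal G})=\{M\sqsubseteq N: M_\rho\subseteq N_\rho$ for all $\rho\}$ and ${\rm Eq}({\cal G})=\{M=N:M_\rho=N_\rho$ for all $\rho\}$. A graph model ${\cal P}$ is a sub graph model of ${\cal G}$ if $P\subseteq G$ and $c_{\cal P}$ is the restriction of $c_{\cal G}$ to $P^*\times P$. *)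

(* Defs.v *)
From mathcomp Require Import all_boot.
From mathcomp Require Import boolp classical_sets functions cardinality.

Set Implicit Arguments.
Unset Strict Implicit.
Unset Printing Implicit Defensive.

Local Open Scope classical_set_scope.

Inductive term : Type :=
| Var of nat
| App of term & term
| Lam of nat & term.

Definition fsubsets (D : Type) (A : set D) : set (set D) :=
  [set a | finite_set a /\ a `<=` A].

(* The web of a model is a subset of an ambient type D, so that inclusion of
   webs is inclusion of sets.  The values of coding outside
   fsubsets carrier `*` carrier are irrelevant: nothing below uses them. *)
Record graph_model (D : Type) := GraphModel {
  carrier : set D;
  coding : set D * D -> D;
  carrier_infinite : infinite_set carrier;
  coding_total : set_fun (fsubsets carrier `*` carrier) carrier coding;
  coding_inj : set_inj (fsubsets carrier `*` carrier) coding
}.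

Definition sub_graph_model (D : Type) (P G : graph_model D) : Prop :=
  carrier P `<=` carrier G /\
  {in fsubsets (carrier P) `*` carrier P, coding P =1 coding G}.

Definition env (D : Type) := nat -> set D.

Definition is_env (D : Type) (G : graph_model D) (rho : env D) : Prop :=
  forall x, rho x `<=` carrier G.

Definition upd (D : Type) (rho : env D) (x : nat) (a : set D) : env D :=
  fun y => if y == x then a else rho y.

Fixpoint interp (D : Type) (G : graph_model D) (M : term) (rho : env D) :
    set D :=
  match M with
  | Var x => rho x
  | App M N =>
      [set alpha | carrier G alpha /\
         exists a, [/\ finite_set a, a `<=` interp G N rho &
                       interp G M rho (coding G (a, alpha))]]
  | Lam x M =>
      [set beta | exists a alpha, [/\ fsubsets (carrier G) a,
         interp G M (upd rho x a) alpha & beta = coding G (a, alpha)]]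
  end.

Lemma interp_sub (D : Type) (G : graph_model D) (M : term) (rho : env D) :
  is_env G rho -> interp G M rho `<=` carrier G.
Proof.
elim: M rho => [x|M _ N _|x M IHM] rho Hrho /=; first exact: Hrho.
  by move=> alpha [].
move=> _ [a [alpha [Ga Malpha ->]]]; apply: coding_total; split=> //=.
apply: IHM Malpha => y; rewrite /upd; case: ifP => _; last exact: Hrho.
by case: Ga.
Qed.

(* The pair (M, N) stands for the inequation M ⊑ N in Ord and for the
   equation M = N in Eq. *)
Definition Ord (D : Type) (G : graph_model D) : set (term * term) :=
  [set MN | forall rho, is_env G rho ->
              interp G MN.1 rho `<=` interp G MN.2 rho].

Definition Eq (D : Type) (G : graph_model D) : set (term * term) :=
  [set MN | forall rho, is_env G rho ->
              interp G MN.1 rho = interp G MN.2 rho].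

(* Main.v *)
(** Interpretations are continuous, so membership of a point in the
    interpretation of a term depends only on a finite part of the environment.
    A countable subset [P] of the web that is closed under the coding and its
    partial inverse, and under witnesses for memberships in applications with
    finite parameters in [P], is therefore elementary: for environments in [P],
    interpreting in [P] amounts to interpreting in [G] and intersecting with
    [P].  Hence the inequations of [G] hold in [P]; conversely, a failing
    inequation fails in [P] once [P] contains a finite counterexample. *)

Require Import Defs.
From mathcomp Require Import all_boot.
From mathcomp Require Import boolp classical_sets functions cardinality.

Set Implicit Arguments.
Unset Strict Implicit.
Unset Printing Implicit Defensive.

Local Open Scope classical_set_scope.

(** * Countable closures and countability of terms *)

Lemma finite_sub_bigcup_chain (T : Type) (X : nat -> set T) (a : set T) :
  (forall m n, m <= n -> X m `<=` X n) ->
  finite_set a -> a `<=` \bigcup_n X n -> exists n, a `<=` X n.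
Proof.
move=> Xmono /(@finite_seqP {classic T})[s ->].
elim: s => [|x s IHs] sX; first by exists 0 => y; rewrite /= in_nil.
have [|n sn] := IHs; first by move=> y ys; apply: sX; rewrite /= inE ys orbT.
have [|m _ xm] := sX x; first by rewrite /= inE eqxx.
exists (maxn m n) => y /=; rewrite inE => /predU1P[->|ys].
  exact: Xmono (leq_maxl m n) _ xm.
exact: Xmono (leq_maxr m n) _ (sn _ ys).
Qed.

(** Iterate [X |-> X \cup H X] from [X0] and take the union of the stages: since [H] is finitary,
    what it yields on the union is already yielded on some stage, hence lies in the next one. *)
Lemma countable_finitary_closure (D : Type) (A X0 : set D) (H : set D -> set D) :
  countable X0 -> X0 `<=` A ->
  (forall X, countable X -> X `<=` A -> countable (H X) /\ H X `<=` A) ->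
  (forall X : nat -> set D, (forall m n, m <= n -> X m `<=` X n) ->
    H (\bigcup_n X n) `<=` \bigcup_n H (X n)) ->
  exists P, [/\ countable P, X0 `<=` P, P `<=` A & H P `<=` P].
Proof.
move=> X0c X0A HA Hfin; pose X n := iter n (fun Y => Y `|` H Y) X0.
have XcA n : countable (X n) /\ X n `<=` A.
  elim: n => [//|n [Xc XA]] /=; have [Hc HXA] := HA _ Xc XA.
  split; last by move=> d [/XA|/HXA].
  by rewrite -bigcup2E; apply: bigcup_countable => // -[|[|k]] _ //=.
have Xmono m n : m <= n -> X m `<=` X n.
  move=> /subnK <-; elim: (n - m) => [//|k IHk] d /IHk Xd; by left.
exists (\bigcup_n X n); split.
- by apply: bigcup_countable => // n _; have [] := XcA n.
- by move=> d X0d; exists 0.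
- by move=> d [n _ /(proj2 (XcA n))].
- by move=> d /(Hfin _ Xmono)[n _ Hd]; exists n.+1 => //; right.
Qed.

(** The embedding transports the countability of [GenTree.tree nat] to terms; the label 0 is
    reserved for applications, hence the shift [x.+1] for binders. *)
Fixpoint tree_of_term (M : term) : GenTree.tree nat :=
  match M with
  | Var x => GenTree.Leaf x
  | App M N => GenTree.Node 0 [:: tree_of_term M; tree_of_term N]
  | Lam x M => GenTree.Node x.+1 [:: tree_of_term M]
  end.

Lemma tree_of_term_inj : injective tree_of_term.
Proof.
elim=> [x|M IHM N IHN|x M IHM] [y|M' N'|y M'] //=; first by case=> ->.
  by case=> /IHM -> /IHN ->.
by case=> -> /IHM ->.
Qed.

Lemma countable_term : countable [set: term].
Proof.
apply/countable_injP; exists (pickle \o tree_of_term) => M N _ _.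
by move=> /(pcan_inj pickleK)/tree_of_term_inj.
Qed.

(** * Monotonicity and continuity of interpretation *)

Section GraphModel.
Variables (D : Type) (G : graph_model D).

Lemma interp_mono (M : term) (rho rho' : env D) :
  (forall x, rho x `<=` rho' x) -> interp G M rho `<=` interp G M rho'.
Proof.
elim: M rho rho' => [x|M IHM N IHN|x M IHM] rho rho' rr' /=; first exact: rr'.
  move=> alpha [Galpha [a [afin aN aM]]]; split=> //; exists a; split=> //.
    exact: subset_trans aN (IHN _ _ rr').
  exact: IHM aM.
move=> _ [a [alpha [Ga Malpha ->]]]; exists a, alpha; split=> //.
by apply: IHM Malpha => y; rewrite /upd; case: (y == x) => // d; apply: rr'.
Qed.

(** Environments are presented by their graphs so that a finite part of one is a finite set of
    pairs; over a countable set of points there are only countably many of these. *)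
Definition env_of (E : set (nat * D)) : env D := fun x => [set d | E (x, d)].

Definition env_graph (rho : env D) : set (nat * D) := [set xd | rho xd.1 xd.2].

Lemma interp_env_of_sub (M : term) (E : set (nat * D)) (rho : env D) :
  E `<=` env_graph rho -> interp G M (env_of E) `<=` interp G M rho.
Proof. by move=> Erho; apply: interp_mono => x d /Erho. Qed.

Lemma interp_env_of_mono (M : term) (E F : set (nat * D)) :
  E `<=` F -> interp G M (env_of E) `<=` interp G M (env_of F).
Proof. by move=> EF; apply: interp_env_of_sub => -[x d] /EF. Qed.

(** Unites the finite supports of the points of [a]. Continuity at [M] is a hypothesis because the
    lemma serves inside the induction that proves it. *)
Lemma continuous_finite (M : term) (rho : env D) (a : set D) :
  (forall alpha, interp G M rho alpha -> exists E,
    [/\ finite_set E, E `<=` env_graph rho & interp G M (env_of E) alpha]) ->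
  finite_set a -> a `<=` interp G M rho ->
  exists E, [/\ finite_set E, E `<=` env_graph rho &
                a `<=` interp G M (env_of E)].
Proof.
move=> Mcont /(@finite_seqP {classic D})[s ->].
elim: s => [|d s IHs] sM; first by exists set0; split=> // d; rewrite /= in_nil.
have [|E [Efin Er sE]] := IHs.
  by move=> e es; apply: sM; rewrite /= inE es orbT.
have [|F [Ffin Fr dF]] := Mcont d; first by apply: sM; rewrite /= inE eqxx.
exists (F `|` E); split; first by rewrite finite_setU.
  by move=> e [/Fr|/Er].
move=> e /=; rewrite inE => /predU1P[->|/sE].
  by apply: interp_env_of_mono dF => ? ?; left.
by apply: interp_env_of_mono => ? ?; right.
Qed.

Lemma interp_continuous (M : term) (rho : env D) (alpha : D) :
  interp G M rho alpha -> exists E,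
    [/\ finite_set E, E `<=` env_graph rho & interp G M (env_of E) alpha].
Proof.
elim: M rho alpha => [x|M IHM N IHN|x M IHM] rho alpha /=.
- by move=> rxa; exists [set (x, alpha)]; split=> // _ ->.
- move=> [Galpha [a [afin aN /IHM[E [Efin Er aM]]]]].
  have [F [Ffin Fr aF]] := continuous_finite (IHN rho) afin aN.
  exists (E `|` F); split; first by rewrite finite_setU.
    by move=> e [/Er|/Fr].
  split=> //; exists a; split=> //.
    by apply: subset_trans aF _; apply: interp_env_of_mono => ? ?; right.
  by apply: interp_env_of_mono aM => ? ?; left.
move=> [a [gamma [Ga /IHM[E [Efin Er gE]] ->]]].
exists (E `&` [set yd | yd.1 != x]); split.
- exact: finite_setIl.
- by move=> [y d] [/Er]; rewrite /env_graph /upd /= => + /negPf yx; rewrite yx.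
exists a, gamma; split=> //.
apply: interp_mono gE => y d; rewrite /env_of /upd /= => Eyd.
by have := Er _ Eyd; rewrite /env_graph /upd /=; case: eqVneq.
Qed.

(** * A criterion for elementary submodels *)

Section Submodel.
Variable P : graph_model D.
Hypothesis codingP : coding P = coding G.
Hypothesis subP : carrier P `<=` carrier G.
Hypothesis decodeP : forall a alpha, fsubsets (carrier G) a ->
  carrier G alpha -> carrier P (coding G (a, alpha)) ->
  a `<=` carrier P /\ carrier P alpha.
Hypothesis appP : forall M N E alpha, finite_set E ->
  E `<=` [set: nat] `*` carrier P -> carrier P alpha ->
  interp G (App M N) (env_of E) alpha ->
  exists a, [/\ fsubsets (carrier P) a, a `<=` interp G N (env_of E) &
                interp G M (env_of E) (coding G (a, alpha))].

(** A Tarski-Vaught argument: in passing from [G] to [P], an application needs its finite argument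
    set inside [P], given by [appP], and an abstraction needs its code to decode inside [P], given
    by [decodeP]. *)
Lemma interp_submodel (M : term) (rho : env D) :
  is_env P rho -> interp P M rho = interp G M rho `&` carrier P.
Proof.
elim: M rho => [x|M IHM N IHN|x M IHM] rho Prho /=.
- by apply/seteqP; split=> [d rd|d []//]; split=> //; apply: Prho rd.
- rewrite IHM// IHN// codingP; apply/seteqP; split=> alpha.
    move=> [Palpha [a [afin aN [aM _]]]]; split=> //; split; first exact: subP.
    by exists a; split=> // d /aN[].
  (* Since [appP] accepts finite parameters only, continuity first replaces [rho] by a finite part
     [E]; monotonicity then brings the witness back to [rho]. *)
  move=> [/(@interp_continuous (App M N))[E [Efin Er aMN]] Palpha]; split=> //.
  have EP : E `<=` [set: nat] `*` carrier P.
    by move=> [x d] /Er; split=> //; apply: (Prho x).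
  have [a [[afin aP] aN aM]] := appP Efin EP Palpha aMN.
  exists a; split=> //.
    by move=> d ad; split; [exact: interp_env_of_sub Er _ (aN _ ad)|exact: aP].
  split; first exact: interp_env_of_sub Er _ aM.
  by rewrite -codingP; apply: coding_total.
have Pupd a : fsubsets (carrier P) a -> is_env P (upd rho x a).
  by move=> [_ aP] y; rewrite /upd; case: ifP.
apply/seteqP; split=> beta.
  move=> [a [alpha [Pa aM ->]]].
  have [aMG Palpha] : (interp G M (upd rho x a) `&` carrier P) alpha.
    by rewrite -IHM//; apply: Pupd.
  split; last by apply: coding_total.
  exists a, alpha; rewrite codingP; split=> //.
  by case: Pa => afin aP; split=> // d /aP/subP.
move=> [[a [alpha [Ga aM ->]]] Pbeta].
have Galpha : carrier G alpha.
  apply: interp_sub aM => y; rewrite /upd; case: ifP => _; first by case: Ga.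
  exact: subset_trans (Prho y) subP.
have [aP Palpha] := decodeP Ga Galpha Pbeta.
have Pa : fsubsets (carrier P) a by case: Ga.
by exists a, alpha; rewrite codingP IHM//; apply: Pupd.
Qed.

End Submodel.

(** * Skolem witnesses and countable hulls *)

(* The last clause reads the finite set to be coded off the environment at 0, so
   that all closure conditions share the finitary parameters [E] and [alpha]. *)
Definition skolem_witness (M N : term) (E : set (nat * D)) (alpha : D)
    (w : set D) : Prop :=
  [/\ fsubsets (carrier G) w,
      interp G (App M N) (env_of E) alpha -> exists a,
        [/\ finite_set a, a `<=` w, a `<=` interp G N (env_of E) &
            interp G M (env_of E) (coding G (a, alpha))],
      forall a gamma, fsubsets (carrier G) a -> carrier G gamma ->
        alpha = coding G (a, gamma) -> a `<=` w /\ w gamma &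
      fsubsets (carrier G) (env_of E 0) -> carrier G alpha ->
        w (coding G (env_of E 0, alpha))].

(** Finiteness survives finite unions and the other clauses survive enlarging [w], so each clause is
    met separately and the results are united. *)
Lemma skolem_witness_exists M N E alpha :
  is_env G (env_of E) -> exists w, skolem_witness M N E alpha w.
Proof.
move=> GE.
have [w1 [Gw1 w1P]] : exists w, fsubsets (carrier G) w /\
    (interp G (App M N) (env_of E) alpha -> exists a,
      [/\ finite_set a, a `<=` w, a `<=` interp G N (env_of E) &
          interp G M (env_of E) (coding G (a, alpha))]).
  have [[Ga [a [afin aN aM]]]|nMN] :=
    pselect (interp G (App M N) (env_of E) alpha).
    exists a; split; last by move=> _; exists a; split.
    by split=> // d /aN /(interp_sub GE).
  by exists set0; split=> //; split.
have [w2 [Gw2 w2P]] : exists w, fsubsets (carrier G) w /\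
    forall a gamma, fsubsets (carrier G) a -> carrier G gamma ->
      alpha = coding G (a, gamma) -> a `<=` w /\ w gamma.
  have [[[a gamma] [[Ga Ggamma] codE]]|ncod] := pselect (exists p,
      (fsubsets (carrier G) `*` carrier G) p /\ alpha = coding G p).
    exists (a `|` [set gamma]); split.
      case: Ga => afin aG; split; first by rewrite finite_setU.
      by move=> d [/aG//|->].
    move=> b delta Gb Gdelta; rewrite codE => codab.
    (* Injectivity of the coding makes the decomposition of [alpha] unique, so one finite set serves
       all pairs. *)
    have [<- <-] : (a, gamma) = (b, delta).
      by apply: (@coding_inj _ G); rewrite ?inE.
    by split=> [d|]; [left|right].
  exists set0; split; first by split.
  move=> a gamma Ga Ggamma codE.
  by case: ncod; exists (a, gamma).
(* The third set is a singleton or empty, according to whether the pair lies in the domain of the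
   coding. *)
exists (w1 `|` w2 `|` [set d | [/\ d = coding G (env_of E 0, alpha),
  fsubsets (carrier G) (env_of E 0) & carrier G alpha]]); split.
- case: Gw1 Gw2 => w1fin w1G [w2fin w2G]; split.
    rewrite !finite_setU; split; first by split.
    by apply: sub_finite_set (finite_set1 (coding G (env_of E 0, alpha))) => d [].
  by move=> d [[/w1G|/w2G]|[-> ? ?]] //; apply: coding_total.
- by move=> /w1P[a [? aw ? ?]]; exists a; split=> // d /aw; left; left.
- move=> a gamma Ga Gg /w2P[]// aw wg.
  by split=> [d /aw|]; left; right.
- by right.
Qed.

Lemma Ord_counterexample (MN : term * term) : exists w,
  [/\ countable w, w `<=` carrier G &
      ~ Ord G MN -> exists E alpha,
        [/\ E `<=` [set: nat] `*` w, w alpha,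
            interp G MN.1 (env_of E) alpha &
            ~ interp G MN.2 (env_of E) alpha]].
Proof.
have [GMN|] := pselect (Ord G MN); first by exists set0; split.
move=> /existsNP[rho /not_implyP[Grho /existsNP[alpha /not_implyP[Ma nNa]]]].
have [E [Efin Er MEa]] := interp_continuous Ma.
exists (snd @` E `|` [set alpha]); split.
- by apply: finite_set_countable; rewrite finite_setU; split=> //; apply: finite_image.
- move=> _ [[[x d] /Er rxd <-]|->]; first exact: Grho rxd.
  exact: interp_sub Ma.
move=> _; exists E, alpha; split=> //; last by move=> /(interp_env_of_sub Er).
- by move=> xd Exd; split=> //; left; exists xd.
- by right.
Qed.

Lemma skolem_hull (X0 : set D) :
  countable X0 -> X0 `<=` carrier G -> exists P,
  [/\ countable P, X0 `<=` P, P `<=` carrier G &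
      forall M N E alpha, finite_set E -> E `<=` [set: nat] `*` P -> P alpha ->
        exists w, skolem_witness M N E alpha w /\ w `<=` P].
Proof.
move=> X0c X0G.
(* Witnesses are fixed once for all parameters, so that the closure operator is a function of the
   set alone. *)
have /choice[W WP] : forall p : term * term * set (nat * D) * D, exists w,
    is_env G (env_of p.1.2) -> skolem_witness p.1.1.1 p.1.1.2 p.1.2 p.2 w.
  move=> [[[M N] E] alpha] /=.
  have [/(skolem_witness_exists M N alpha)[w wP]|nG] :=
    pselect (is_env G (env_of E)); first by exists w.
  by exists set0.
pose params (X : set D) : set (term * term * set (nat * D) * D) :=
  [set: term * term] `*`
    [set E | E `<=` [set: nat] `*` X /\ finite_set E] `*` X.
have params_env X p : X `<=` carrier G -> params X p -> is_env G (env_of p.1.2).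
  by move=> XG [[_ [EX _]] _] x d /EX[_ /XG].
have [X Xc XG|X Xmono|P [Pc X0P PG HP]] :=
    @countable_finitary_closure D (carrier G) X0
      (fun X => \bigcup_(p in params X) W p) X0c X0G.
- split.
    apply: bigcup_countable => [|p Xp]; last first.
      have [[wfin _] _ _ _] := WP p (params_env _ _ XG Xp).
      exact: finite_set_countable.
    apply: countableX => //; apply: countableX.
      by rewrite -setXTT; apply: countableX; apply: countable_term.
    by apply: countable_finite_subset; apply: countableX.
  by move=> d [p /(params_env _ _ XG)/WP[[_ wG] _ _ _] /wG].
(* Finitarity: the finite set [E] and the point [alpha] both lie in a single stage of the chain. *)
- move=> d [[[MN E] alpha] [[_ [/= EX Efin]] [m _ Xalpha]] Wd].
  have [k k' kk' xd [_ Xd]|//|xd /EX[_ [k _ Xd]]|n En] :=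
      @finite_sub_bigcup_chain _ (fun n => [set: nat] `*` X n) E.
  - by split=> //; apply: Xmono Xd.
  - by exists k.
  exists (maxn m n) => //; exists (MN, E, alpha) => //; split.
    split=> //; split=> // xd /En[_ Xd]; split=> //.
    exact: Xmono (leq_maxr m n) _ Xd.
  exact: Xmono (leq_maxl m n) _ Xalpha.
exists P; split=> // M N E alpha Efin EP Palpha.
have Pp : params P (M, N, E, alpha) by [].
exists (W (M, N, E, alpha)); split; first exact: WP (params_env _ _ PG Pp).
by move=> d Wd; apply: HP; exists (M, N, E, alpha).
Qed.

End GraphModel.

Lemma Eq_Ord (D : Type) (G : graph_model D) :
  Eq G = [set MN | Ord G MN /\ Ord G (MN.2, MN.1)].
Proof.
apply/seteqP; split=> MN.
  by move=> E; split=> rho Grho /=; rewrite (E rho Grho).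
by move=> [MN_ NM] rho Grho; apply/seteqP; split; [exact: MN_|exact: NM].
Qed.

Theorem theorem8 (D : Type) (G : graph_model D) :
  exists P : graph_model D,
    [/\ sub_graph_model P G,
        countable (carrier P),
        Ord P = Ord G &
        Eq P = Eq G].
Proof.
suff [P [subP Pc OrdP]] : exists P : graph_model D,
    [/\ sub_graph_model P G, countable (carrier P) & Ord P = Ord G].
  by exists P; split=> //; rewrite !Eq_Ord OrdP.
have [C CP] := choice (@Ord_counterexample D G).
(* Including [S] in the hull keeps the new web infinite. *)
have [S [Sinf Sc SG]] : exists S : set D,
    [/\ infinite_set S, countable S & S `<=` carrier G].
  have /infiniteP/card_subP[S natS SG] := @carrier_infinite D G.
  exists S; split=> //; last by rewrite (eq_countable natS).
  by apply/infiniteP; rewrite (card_le_eqr natS).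
pose X0 := S `|` \bigcup_MN C MN.
have X0c : countable X0.
  rewrite /X0 -bigcup2E; apply: bigcup_countable => // -[|[|k]] _ //=.
  apply: bigcup_countable => [|MN _]; last by have [] := CP MN.
  by rewrite -setXTT; apply: countableX; apply: countable_term.
have X0G : X0 `<=` carrier G.
  by move=> d [/SG//|[MN _]]; have [_ CG _] := CP MN; apply: CG.
have [P [Pc X0P PG HP]] := skolem_hull X0c X0G.
have codP : set_fun (fsubsets P `*` P) P (coding G).
  move=> [a alpha] [[afin aP] Palpha] /=.
  (* The terms are dummies; the environment takes the value [a] at 0, where the coding clause reads
     it. *)
  have [||w [[_ _ _ wcode] wP]] :=
      HP (Var 0) (Var 0) ([set 0] `*` a) alpha _ _ Palpha.
  - exact: finite_setX.
  - by move=> xd [_ /aP].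
  have aE : env_of ([set 0] `*` a) 0 = a.
    by apply/seteqP; split=> d; [case|split].
  apply: wP; move: wcode; rewrite aE; apply; last exact: PG.
  by split=> // d /aP/PG.
have fsubPG : fsubsets P `*` P `<=` fsubsets (carrier G) `*` carrier G.
  by move=> [a alpha] [[afin aP] /PG Galpha]; split=> //; split=> // d /aP/PG.
have injP : set_inj (fsubsets P `*` P) (coding G).
  by apply: sub_in2 (@coding_inj _ G) => p; rewrite !inE => /fsubPG.
have Pinf : infinite_set P by apply: sub_infinite_set Sinf => d Sd; apply: X0P; left.
pose PM := GraphModel Pinf codP injP.
have PME M rho : is_env PM rho -> interp PM M rho = interp G M rho `&` P.
  apply: interp_submodel => //.
  - move=> a alpha Ga Galpha Pcod.
    have [||w [[_ _ wdec _] wP]] :=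
      HP (Var 0) (Var 0) set0 (coding G (a, alpha)) _ _ Pcod => //.
    have [aw walpha] := wdec a alpha Ga Galpha erefl.
    by split; [exact: subset_trans aw wP|exact: wP].
  - move=> M' N' E alpha Efin EP Palpha aMN.
    have [w [[_ wapp _ _] wP]] := HP M' N' E alpha Efin EP Palpha.
    have [a [afin aw aN aM]] := wapp aMN.
    by exists a; split=> //; split=> //; apply: subset_trans aw wP.
exists PM; split=> //.
apply/seteqP; split=> MN OMN; last first.
  move=> rho Prho; rewrite !PME//; apply: setSI; apply: OMN => x.
  exact: subset_trans (Prho x) PG.
(* The counterexample chosen in [C MN] lies in [P], so it refutes the inequation in the submodel. *)
apply: contrapT => nO.
have [_ _ /(_ nO)[E [alpha [EC Calpha Malpha nNalpha]]]] := CP MN.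
have CsubP : C MN `<=` P by move=> d Cd; apply: X0P; right; exists MN.
have PE : is_env PM (env_of E) by move=> x d /EC[_ /CsubP].
have := OMN _ PE alpha; rewrite !PME// => /(_ (conj Malpha (CsubP _ Calpha))).
by case.
Qed.
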